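(* Let $X$ be the AR($p$)-process with coefficients $(a_1,\dots,a_p)$ such that all (complex) roots of the characteristic polynomial $f_p(z)=z^p-\sum_{k=1}^pa_kz^{p-k}$ have modulus strictly less than $1$. Assume $\mathbb{E}[Y_1]=0$ and $|Y_1|\le M<\infty$ a.s. Then there is $x_0\ge0$ such that for all $x\ge x_0$, $$\mathbb{P}\Big(\sup_{n=1,\dots,N}\sum_{k=1}^nX_k\le x\Big)\asymp N^{-1/2},\quad N\to\infty.$$
   Context: Let $(Y_n)_{n\ge1}$ be i.i.d. nondegenerate real random variables. The AR($p$)-process is $X_n=\sum_{k=1}^pa_kX_{n-k}+Y_n$ for $n\ge1$ with $X_n=0$ for $n\le0$. $f\asymp g$ means $0<\liminf f/g\le\limsup f/g<\infty$. *)

(* Defs.v *)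
From HB Require Import structures.
From mathcomp Require Import all_boot all_order all_algebra.
From mathcomp Require Import all_classical all_reals all_analysis.
From mathcomp Require complex.
Import complex.ComplexField.
Set Implicit Arguments. Unset Strict Implicit. Unset Printing Implicit Defensive.
Import Order.TTheory GRing.Theory Num.Theory.
Local Open Scope classical_set_scope.
Local Open Scope ring_scope.

Section Defs.
Context (d : measure_display) (T : measurableType d) (R : realType)
        (P : probability T R).

Definition mutually_independent (Y : nat -> T -> R) : Prop :=
  forall (s : seq nat) (B : nat -> set R),
    uniq s -> (forall i, i \in s -> measurable (B i)) ->
    P (\big[setI/setT]_(i <- s) (Y i @^-1` B i)) =
    (\prod_(i <- s) P (Y i @^-1` B i))%E.

Definition identically_distributed (Y : nat -> T -> R) : Prop :=
  forall n (B : set R), measurable B -> P (Y n @^-1` B) = P (Y 0%N @^-1` B).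

Definition nondegenerate_rv (Z : T -> R) : Prop :=
  ~ (exists c : R, P (Z @^-1` [set c]) = 1%E).
End Defs.

Definition ar_char_poly (R : nzRingType) (p : nat) (a : nat -> R) : {poly R} :=
  'X^p - \sum_(1 <= k < p.+1) (a k)%:P * 'X^(p - k).

(** f ≍ g for positive sequences, with f/g given as an extended-real
    sequence: 0 < liminf f/g  and  limsup f/g < +oo. *)
Definition asymp_ratio (R : realType) (r : nat -> \bar R) : Prop :=
  (0 < limn_einf r)%E /\ (limn_esup r < +oo)%E.

(* Main.v *)
(** Summing the recursion gives [f(1) (X_1 + ... + X_n) = S_n + O(1)], where [S] is
    the random walk with steps [Y], because the roots of [f] lie in the open
    unit disk, so that [X] is bounded when [Y] is; moreover [f(1) > 0] since [f] is
    monic and has no root in [[1, +oo[].  It remains to show that [S] stays below a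
    level [u] up to time [N] with probability of order [N^(-1/2)].  Let [V = u - S].
    - Lower bound: the cubic [v - t (v^3 + 3 m s2 v - m m3) - c], [s2] and [m3] being
      the moments of [Y], is space-time harmonic for the walk, with [m] the remaining
      time.  For suitable [c] it is nonpositive just below [0], so its mean over the
      surviving paths does not decrease.  With [t] of order [1/N] it is bounded by
      [O(sqrt N)] at the final time and is bounded below at time [0].
    - Upper bound: [(v + M) (2 L + M - v)] loses [s2] per step on average.  Stopping
      [V] when it leaves [[0, L]], with [L = M sqrt N], shows that [N s2] times the
      survival probability is at most the initial value, which is [O(sqrt N)]. *)
Require Import Defs.
From HB Require Import structures.
From mathcomp Require Import all_boot all_order all_algebra.
From mathcomp Require Import all_classical all_reals all_analysis.
From mathcomp Require Import measurable_realfun.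
From mathcomp Require Import ring lra zify.
From mathcomp Require complex polyrcf.
Import complex.ComplexField.
Import Order.TTheory GRing.Theory Num.Theory.
Local Open Scope classical_set_scope.
Local Open Scope ring_scope.
Set Implicit Arguments.
Unset Strict Implicit.

(** * Stable linear recursions *)

Definition poly_shift (C : nzRingType) (q : {poly C}) (x : nat -> C) (n : nat) : C :=
  \sum_(i < size q) q`_i * x (n + i)%N.

Lemma poly_shiftE (C : nzRingType) (q : {poly C}) (x : nat -> C) (n m : nat) :
  (size q <= m)%N -> poly_shift q x n = \sum_(i < m) q`_i * x (n + i)%N.
Proof.
move=> qm; rewrite /poly_shift (big_ord_widen m (fun i => q`_i * x (n + i)%N) qm).
rewrite [RHS](bigID (fun i : 'I_m => (i < size q)%N))/= [X in _ + X]big1 ?addr0// => i.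
by rewrite -leqNgt => /leq_sizeP ->//; rewrite mul0r.
Qed.

Lemma poly_shift1 (C : nzRingType) (x : nat -> C) : poly_shift 1 x =1 x.
Proof.
by move=> n; rewrite /poly_shift size_poly1 big_ord1 coef1 mul1r addn0.
Qed.

Lemma poly_shift_XsubCM (C : comNzRingType) (z : C) (q : {poly C}) x n :
  poly_shift (('X - z%:P) * q) x n =
  poly_shift q x n.+1 - z * poly_shift q x n.
Proof.
have le_sz : (size (('X - z%:P) * q)%R <= (size q).+1)%N.
  by rewrite (leq_trans (size_polyMleq _ _))// size_XsubC.
rewrite (poly_shiftE _ _ le_sz) mulrC mulrBr.
under eq_bigr do rewrite coefB mulrBl.
rewrite sumrB; congr (_ - _).
  rewrite big_ord_recl coefMX/= mul0r add0r; apply: eq_bigr => i _.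
  by rewrite coefMX/= addnS addSn.
rewrite (poly_shiftE _ _ (leqnSn _)) mulr_sumr; apply: eq_bigr => i _.
by rewrite coefMC mulrA [z * _]mulrC.
Qed.

Lemma bounded_of_first_order (C : numFieldType) (I : Type) (z : C)
    (x : I -> nat -> C) (K0 K : C) : `|z| < 1 ->
  (forall w, `|x w 0%N| <= K0) ->
  (forall w n, `|x w n.+1 - z * x w n| <= K) ->
  exists K', forall w n, `|x w n| <= K'.
Proof.
move=> z1 x0 xS; pose L := `|K0| + `|K| / (1 - `|z|).
have d0 : 0 < 1 - `|z| by rewrite subr_gt0.
exists L => w; elim=> [|n ih].
  have K00 : 0 <= K0 by exact: le_trans (x0 w).
  by rewrite (le_trans (x0 w))// /L (ger0_norm K00) lerDl divr_ge0// ltW.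
have K00 : 0 <= K by exact: le_trans (xS w 0%N).
rewrite -(subrK (z * x w n) (x w n.+1)) (le_trans (ler_normD _ _))//.
rewrite (le_trans (lerD (xS w n) (lexx _)))// normrM.
apply: (@le_trans _ _ (K + `|z| * L)); first by rewrite lerD2l ler_wpM2l.
have KE : K = (1 - `|z|) * (`|K| / (1 - `|z|)).
  by rewrite mulrC divfK ?gt_eqF// ger0_norm.
rewrite [X in X + _]KE /L mulrDr addrA [_ + `|z| * `|K0|]addrC -addrA -mulrDl subrK mul1r.
by rewrite lerD2r ler_piMl// ltW.
Qed.

Lemma poly_shift_pointwise_bounded (C : numFieldType) (I : Type) (q : {poly C})
    (x : I -> nat -> C) :
  (forall n, exists K, forall w, `|x w n| <= K) ->
  forall n, exists K, forall w, `|poly_shift q (x w) n| <= K.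
Proof.
move=> /choice[K xK] n; exists (\sum_(i < size q) `|q`_i| * K (n + i)%N) => w.
rewrite (le_trans (ler_norm_sum _ _ _))//; apply: ler_sum => i _.
by rewrite normrM ler_wpM2l.
Qed.

Lemma bounded_of_stable_shift (C : numFieldType) (I : Type) (r : seq C)
    (x : I -> nat -> C) (K : C) :
  (forall z, z \in r -> `|z| < 1) ->
  (forall n, exists K, forall w, `|x w n| <= K) ->
  (forall w n, `|poly_shift (\prod_(z <- r) ('X - z%:P)) (x w) n| <= K) ->
  exists K', forall w n, `|x w n| <= K'.
Proof.
move=> + xb; elim: r K => [|z r ih] K r1.
  by rewrite big_nil => xK; exists K => w n; rewrite -poly_shift1.
rewrite big_cons => xK.
have [K0 K0P] :=
  poly_shift_pointwise_bounded (\prod_(z <- r) ('X - z%:P)) xb 0%N.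
have [||w n|K' K'P] := @bounded_of_first_order C I z
  (fun w => poly_shift (\prod_(z <- r) ('X - z%:P)) (x w)) K0 K.
- by apply: r1; rewrite mem_head.
- exact: K0P.
- by rewrite -poly_shift_XsubCM.
by apply: (ih K') => // u ur; apply: r1; rewrite in_cons ur orbT.
Qed.

Section ar_recursion.
Context (R : realType) (p : nat) (a : nat -> R).

Lemma size_ar_tail :
  (size (\sum_(1 <= k < p.+1) (a k)%:P * 'X^(p - k))%R <= p)%N.
Proof.
apply: (leq_trans (size_sum _ _ _)); rewrite big_seq.
apply/bigmax_leqP_seq => k; rewrite mem_index_iota => /andP[k0 kp] _.
rewrite (leq_trans (size_polyMleq _ _))// size_polyXn addnS/=.
by rewrite size_polyC; case: (a k != 0) => /=; lia.
Qed.

Lemma lead_coef_ar_char_poly : lead_coef (ar_char_poly p a) = 1.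
Proof.
by rewrite /ar_char_poly lead_coefDl ?lead_coefXn// size_polyN size_polyXn ltnS size_ar_tail.
Qed.

Lemma size_ar_char_poly : size (ar_char_poly p a) = p.+1.
Proof.
by rewrite /ar_char_poly size_polyDl ?size_polyXn// size_polyN ltnS size_ar_tail.
Qed.

Lemma horner_ar_char_poly1 :
  (ar_char_poly p a).[1] = 1 - \sum_(1 <= k < p.+1) a k.
Proof.
rewrite /ar_char_poly hornerD hornerN hornerXn expr1n horner_sum; congr (_ - _).
by apply: eq_bigr => k _; rewrite hornerM hornerC hornerXn expr1n mulr1.
Qed.

Lemma poly_shift_ar_char_poly (x : nat -> R) n :
  poly_shift (ar_char_poly p a) x n =
  x (n + p)%N - \sum_(1 <= k < p.+1) a k * x (n + p - k)%N.
Proof.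
rewrite /poly_shift size_ar_char_poly /ar_char_poly.
under eq_bigr do rewrite coefB coefXn mulrBl coef_sum mulr_suml.
rewrite sumrB; congr (_ - _).
  rewrite big_ord_recr/= eqxx mul1r big1 ?add0r// => i _.
  by rewrite (ltn_eqF (ltn_ord i)) mul0r.
rewrite exchange_big/= big_nat [RHS]big_nat; apply: eq_bigr => k /andP[k0 kp].
have pk : (p - k < p.+1)%N by lia.
rewrite (bigD1 (Ordinal pk))//= [X in _ + X]big1 ?addr0.
  by rewrite coefCM coefXn eqxx mulr1 addnBA.
move=> i ik; rewrite coefCM coefXn.
rewrite (_ : _ == _ = false) ?mulr0 ?mul0r//.
by apply: contraNF ik => /eqP ik; exact/eqP/val_inj.
Qed.

Hypothesis stable : forall z : complex.complex R,
  root (map_poly (fun c : R => complex.Complex c 0) (ar_char_poly p a)) z ->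
  `|z| < 1.

Lemma ar_char_poly1_gt0 : 0 < 1 - \sum_(1 <= k < p.+1) a k.
Proof.
rewrite -horner_ar_char_poly1 ltNge; apply/negP => f1.
have [|b bP] := @polyrcf.poly_pinfty_gt_lc R (ar_char_poly p a).
  by rewrite lead_coef_ar_char_poly.
pose c := Num.max b 1.
have fc : 0 <= (ar_char_poly p a).[c].
  by rewrite (le_trans _ (bP c _)) ?lead_coef_ar_char_poly// /c le_max lexx.
have c1 : 1 <= c by rewrite /c le_max lexx orbT.
have [|s /andP[s1 _] /eqP fs] := poly_ivt c1 (p := ar_char_poly p a).
  by rewrite f1 fc.
have := @stable (complex.real_complex R s).
rewrite (_ : root _ _); last first.
  rewrite /root (_ : map_poly _ _ = map_poly (complex.real_complex R) (ar_char_poly p a))//.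
  by rewrite horner_map/= fs rmorph0.
move=> /(_ isT); rewrite complex.normc_def/= expr0n/= addr0 sqrtr_sqr.
by rewrite complex.ltcR ger0_norm ?(le_trans _ s1)// ltNge s1.
Qed.

Import complex.
Lemma ar_bounded (I : Type) (x y : I -> nat -> R) (M : R) :
  (forall w n, `|y w n| <= M) ->
  (forall w, x w 0%N = 0) ->
  (forall w n, x w n.+1 =
     \sum_(1 <= k < p.+1) a k * x w (n.+1 - k)%N + y w n) ->
  exists2 K, 0 <= K & forall w n, `|x w n| <= K.
Proof.
move=> yM x0 xS.
have xb n : exists K, forall w, `|x w n| <= K.
  have: exists K, forall m, (m <= n)%N -> forall w, `|x w m| <= K.
    elim: n => [|n [K KP]].
      by exists 0 => m; rewrite leqn0 => /eqP -> w; rewrite x0 normr0.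
    exists (Num.max K (\sum_(1 <= k < p.+1) `|a k| * K + M)) => m.
    rewrite leq_eqVlt => /predU1P[-> w|mn w]; last first.
      by rewrite le_max KP.
    rewrite le_max xS; apply/orP; right.
    rewrite (le_trans (ler_normD _ _))// lerD//.
    rewrite (le_trans (ler_norm_sum _ _ _))// big_nat [leRHS]big_nat.
    by apply: ler_sum => k /andP[k0 _]; rewrite normrM ler_wpM2l// KP//; lia.
  by move=> [K KP]; exists K => w; exact: KP.
suff [K KP] : exists K, forall w n, `|x w n| <= K.
  exists `|K| => // w n; exact: le_trans (KP w n) (ler_norm _).
pose C : numClosedFieldType := complex.complex R.
pose f : {poly C} := map_poly (complex.real_complex R) (ar_char_poly p a).
have fm : lead_coef f = 1 by rewrite lead_coef_map lead_coef_ar_char_poly rmorph1.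
have [r] := closed_field_poly_normal f; rewrite fm scale1r => fr.
have nc (c : R) : `|complex.real_complex R c| = complex.real_complex R `|c|.
  by rewrite complex.normc_def/= expr0n/= addr0 sqrtr_sqr.
have [z zr|n|w n|K KP] := @bounded_of_stable_shift C I r
    (fun w n => complex.real_complex R (x w n)) (complex.real_complex R (Num.max M 0)).
- by apply: stable; rewrite (_ : map_poly _ _ = f)// fr root_prod_XsubC.
- have [K KP] := xb n; exists (complex.real_complex R K) => w.
  by rewrite nc complex.lecR.
- rewrite -fr.
  have -> : poly_shift f (fun n => complex.real_complex R (x w n)) n =
      complex.real_complex R (poly_shift (ar_char_poly p a) (x w) n).
    rewrite /poly_shift size_map_poly rmorph_sum; apply: eq_bigr => i _.
    by rewrite coef_map rmorphM.
  rewrite nc complex.lecR poly_shift_ar_char_poly.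
  case m : (n + p)%N => [|k].
    rewrite x0 sub0r normrN big1 => [|k _]; first by rewrite normr0 le_max (lexx 0) orbT.
    by rewrite mulr0.
  by rewrite xS addrAC subrr add0r le_max yM.
exists (complex.Re K) => w n; have := KP w n; rewrite nc.
by rewrite complex.lecE => /andP[_].
Qed.
End ar_recursion.

Lemma partial_sum_ar (R : realType) (p : nat) (a : nat -> R) (x y : nat -> R) n :
  x 0%N = 0 ->
  (forall n, x n.+1 = \sum_(1 <= k < p.+1) a k * x (n.+1 - k)%N + y n) ->
  \sum_(1 <= j < n.+1) x j =
  \sum_(1 <= k < p.+1) a k * \sum_(1 <= j < (n - k).+1) x j + \sum_(i < n) y i.
Proof.
move=> x0 xS; elim: n => [|n ih].
  rewrite big_geq// big_ord0 addr0 big1// => k _.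
  by rewrite mulr0.
rewrite big_nat_recr//= ih xS big_ord_recr/= addrACA -big_split/=; congr (_ + _).
apply: eq_big_nat => k /andP[k0 _]; rewrite -mulrDr; congr (_ * _).
have [kn|nk] := leqP k n; first by rewrite subSn// [in RHS]big_nat_recr.
rewrite (_ : (n - k)%N = 0%N); last lia.
by rewrite (_ : (n.+1 - k)%N = 0%N) ?x0 ?addr0//; lia.
Qed.

Lemma ar_partial_sum_close (R : realType) (p : nat) (a : nat -> R)
    (x y : nat -> R) (K : R) n :
  x 0%N = 0 ->
  (forall n, x n.+1 = \sum_(1 <= k < p.+1) a k * x (n.+1 - k)%N + y n) ->
  (forall n, `|x n| <= K) ->
  `|(1 - \sum_(1 <= k < p.+1) a k) * \sum_(1 <= j < n.+1) x j -
    \sum_(i < n) y i| <= \sum_(1 <= k < p.+1) `|a k| * (k%:R * K).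
Proof.
move=> x0 xS xK; rewrite mulrBl mul1r {1}(partial_sum_ar n x0 xS).
rewrite addrAC addrK mulr_suml -sumrB.
rewrite (le_trans (ler_norm_sum _ _ _))//; apply: ler_sum => k _.
rewrite -mulrBr normrM ler_wpM2l//.
rewrite (@big_cat_nat _ _ _ (n - k).+1 1 n.+1)//=; last by lia.
rewrite opprD addrA subrr add0r normrN (le_trans (ler_norm_sum _ _ _))//.
have K0 : 0 <= K by exact: le_trans (xK 0%N).
rewrite (@le_trans _ _ (\sum_((n - k).+1 <= j < n.+1) K)) ?ler_sum//.
rewrite sumr_const_nat -[leLHS]mulr_natl ler_wpM2r// ler_nat; lia.
Qed.

(** * Independence from the past *)

Definition bounded_measurable d (T : measurableType d) (R : realType)
    (f : T -> R) : Prop :=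
  measurable_fun setT f /\ exists K, forall w, `|f w| <= K.

Section bounded_measurable.
Context d (T : measurableType d) (R : realType).
Implicit Types f g : T -> R.

Lemma bounded_measurable_cst (c : R) : bounded_measurable (fun _ : T => c).
Proof. by split; [exact: measurable_cst|exists `|c|]. Qed.

Lemma bounded_measurableD f g : bounded_measurable f -> bounded_measurable g ->
  bounded_measurable (fun w => f w + g w).
Proof.
move=> [mf [K fK]] [mg [L gL]]; split; first exact: measurable_funD.
by exists (K + L) => w; rewrite (le_trans (ler_normD _ _))// lerD.
Qed.

Lemma bounded_measurableN f : bounded_measurable f ->
  bounded_measurable (fun w => - f w).
Proof.
move=> [mf [K fK]]; split; first exact: measurableT_comp.
by exists K => w; rewrite normrN.
Qed.

Lemma bounded_measurableM f g : bounded_measurable f -> bounded_measurable g ->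
  bounded_measurable (fun w => f w * g w).
Proof.
move=> [mf [K fK]] [mg [L gL]]; split; first exact: measurable_funM.
by exists (K * L) => w; rewrite normrM ler_pM.
Qed.

Lemma bounded_measurableX f n : bounded_measurable f ->
  bounded_measurable (fun w => f w ^+ n).
Proof.
move=> [mf [K fK]]; split; first exact: measurable_funX.
by exists (K ^+ n) => w; rewrite normrX lerXn2r// nnegrE// (le_trans _ (fK w)).
Qed.

Lemma bounded_measurable_sum (n : nat) (f : nat -> T -> R) :
  (forall i, (i < n)%N -> bounded_measurable (f i)) ->
  bounded_measurable (fun w => \sum_(i < n) f i w).
Proof.
elim: n => [|n ih] fb.
  by under eq_fun do rewrite big_ord0; exact: bounded_measurable_cst.
under eq_fun do rewrite big_ord_recr/=.
apply: bounded_measurableD; last exact: fb.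
by apply: ih => i /ltnW; exact: fb.
Qed.

Lemma bounded_measurable_bool (b : T -> bool) : measurable_fun setT b ->
  bounded_measurable (fun w => (b w)%:R : R).
Proof.
move=> mb; split; last by exists 1 => w; case: (b w); rewrite ?normr1 ?normr0.
rewrite (_ : (fun w => _) = fun w => if b w then 1 else 0 : R).
  by apply: measurable_fun_ifT.
by apply/funext => w; case: (b w).
Qed.

Lemma bounded_measurable_integrable (P : probability T R) f :
  bounded_measurable f -> P.-integrable setT (EFin \o f).
Proof.
move=> [mf [K fK]]; apply: measurable_bounded_integrable => //.
  by rewrite (@le_lt_trans _ _ 1%E) ?probability_le1// ltry.
exists K; split; first exact: num_real.
by move=> x Kx w _; rewrite /= (le_trans (fK w))// ltW.
Qed.

End bounded_measurable.

Section expectation_product.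
Context d (T : measurableType d) (R : realType) (P : probability T R).

Lemma Rintegral_mul_indep (f g : T -> R) :
  bounded_measurable f -> bounded_measurable g ->
  (forall A B : set R, measurable A -> measurable B ->
    P (f @^-1` A `&` g @^-1` B) = (P (f @^-1` A) * P (g @^-1` B))%E) ->
  \int[P]_w (f w * g w) = \int[P]_w f w * \int[P]_w g w.
Proof.
move=> bf bg fg; have [mf _] := bf; have [mg _] := bg.
pose F : {mfun T >-> R} := HB.pack f (isMeasurableFun.Build _ _ _ _ f mf).
pose G : {mfun T >-> R} := HB.pack g (isMeasurableFun.Build _ _ _ _ g mg).
pose h w := (f w, g w).
have mh : measurable_fun setT h by exact: measurable_fun_pair.
pose H : {mfun T >-> (R * R)%type} := HB.pack h (isMeasurableFun.Build _ _ _ _ h mh).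
pose muF := distribution P F; pose muG := distribution P G.
have muE A : measurable A -> (muF \x muG)%E A = distribution P H A.
  apply: product_measure_unique => A' B' mA mB.
  by rewrite /muF /muG /distribution /pushforward -fg.
pose m (z : R * R) := (z.1 * z.2)%:E.
have mm : measurable_fun setT m.
  apply/measurable_EFinP; apply: measurable_funM.
    exact: measurable_fst.
  exact: measurable_snd.
have im : P.-integrable setT (m \o h).
  exact: (bounded_measurable_integrable P (bounded_measurableM bf bg)).
have imH : (distribution P H).-integrable setT m.
  by apply: integrable_pushforward => //.
have imFG : (muF \x muG)%E.-integrable setT m.
  move/integrableP : imH => [_ imH]; apply/integrableP; split => //.
  by rewrite (eq_measure_integral (distribution P H))// => A mA _; exact: muE.
have iG : muG.-integrable setT EFin.
  by apply: integrable_pushforward => //; exact: bounded_measurable_integrable.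
have iF : muF.-integrable setT EFin.
  by apply: integrable_pushforward => //; exact: bounded_measurable_integrable.
have eG : (\int[muG]_y y%:E)%E = (\int[P]_w g w)%:E.
  rewrite /Rintegral fineK; last first.
    by apply: integrable_fin_num => //; exact: bounded_measurable_integrable.
  rewrite (@integral_distribution _ _ _ _ _ P G EFin)//.
  exact: bounded_measurable_integrable.
have eF : (\int[muF]_y y%:E)%E = (\int[P]_w f w)%:E.
  rewrite /Rintegral fineK; last first.
    by apply: integrable_fin_num => //; exact: bounded_measurable_integrable.
  rewrite (@integral_distribution _ _ _ _ _ P F EFin)//.
  exact: bounded_measurable_integrable.
rewrite [LHS]/Rintegral.
rewrite -[X in fine X](@integral_distribution _ _ _ _ _ P H m mm im).
rewrite -(eq_measure_integral (distribution P H) (fun A mA _ => muE A mA)).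
rewrite -integral12_prod_meas1// /fubini_F.
under eq_integral do rewrite /m/=; rewrite /=.
under eq_integral => x _.
  under eq_integral do rewrite EFinM.
  rewrite integralZl// eG muleC.
  over.
by rewrite integralZl// eF -EFinM mulrC.
Qed.

End expectation_product.

Definition rectangles (T : Type) (R : realType) (y : nat -> T -> R) (n : nat) :
    set (set T) :=
  [set A | exists2 B : nat -> set R, forall i, measurable (B i) &
     A = \big[setI/setT]_(i <- iota 0 n) (y i @^-1` B i)].

Section past.
Context d (T : measurableType d) (R : realType) (P : probability T R).
Variable y : nat -> T -> R.
Hypothesis my : forall n, measurable_fun setT (y n).

(* The sigma-algebra of [y 0, ..., y n.-1]. *)
Definition past n := g_sigma_algebraType (rectangles y n).

Lemma setI_closed_rectangles n : setI_closed (rectangles y n).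
Proof.
move=> _ _ [B mB ->] [C mC ->]; exists (fun i => B i `&` C i) => [i|].
  exact: measurableI.
by rewrite -big_split; apply: eq_bigr => i _; rewrite preimage_setI.
Qed.

Lemma rectangles_measurable n : rectangles y n `<=` measurable.
Proof.
move=> _ [B mB ->]; apply: bigsetI_measurable => i _.
by rewrite -[X in measurable X]setTI; exact: my.
Qed.

Lemma past_measurable n (A : set T) :
  @measurable _ (past n) A -> measurable A.
Proof.
apply: smallest_sub; last exact: rectangles_measurable.
exact: sigma_algebra_measurable.
Qed.

Lemma measurable_fun_past d' (T' : measurableType d') n (f : T -> T') :
  measurable_fun (setT : set (past n)) f -> measurable_fun setT f.
Proof. by move=> mf _ A mA; apply: (@past_measurable n); exact: mf. Qed.

Lemma past_step i n : (i < n)%N -> measurable_fun (setT : set (past n)) (y i).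
Proof.
move=> ni _ B mB; rewrite setTI; apply: sub_sigma_algebra.
exists (fun j => if j == i then B else setT) => [j|]; first by case: ifP.
rewrite (bigD1_seq i)/= ?iota_uniq ?mem_iota// eqxx big1 => [|j /negPf ->].
  by rewrite setIT.
by rewrite preimage_setT.
Qed.

Lemma past_S n : @measurable _ (past n) `<=` @measurable _ (past n.+1).
Proof.
apply: smallest_sub; first exact: sigma_algebra_measurable.
move=> _ [B mB ->]; apply: sub_sigma_algebra.
exists (fun j => if (j < n)%N then B j else setT) => [j|]; first by case: ifP.
rewrite -addn1 iotaD big_cat/= add0n big_seq1 ltnn preimage_setT setIT.
rewrite big_seq [RHS]big_seq; apply: eq_bigr => i.
by rewrite mem_iota add0n => /andP[_ ->].
Qed.

Lemma measurable_fun_pastS d' (T' : measurableType d') n (f : T -> T') :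
  measurable_fun (setT : set (past n)) f ->
  measurable_fun (setT : set (past n.+1)) f.
Proof. by move=> mf _ A mA; apply: past_S; exact: mf. Qed.

Hypothesis indep : mutually_independent P y.

Lemma past_indep n (A : set T) (B : set R) :
  @measurable _ (past n) A -> measurable B ->
  P (A `&` y n @^-1` B) = (P A * P (y n @^-1` B))%E.
Proof.
move=> mA mB; have mYB : measurable (y n @^-1` B).
  by rewrite -[X in measurable X]setTI; exact: my.
pose H := [set A | measurable A /\
  P (A `&` y n @^-1` B) = (P A * P (y n @^-1` B))%E].
suff : <<s rectangles y n >> `<=` H by move=> /(_ _ mA) [].
apply: lambda_system_subset => //; first exact: setI_closed_rectangles.
- split => //.
  + by split => //; rewrite setTI probability_setT mul1e.
  + move=> C D DC [mC PC] [mD PD]; split; first exact: measurableD.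
    have Plty E : measurable E -> (P E < +oo)%E.
      by move=> mE; rewrite (le_lt_trans (probability_le1 P mE))// ltry.
    have mCB : measurable (C `&` y n @^-1` B) by exact: measurableI.
    rewrite setIDAC setIDA (measureD mCB mD (Plty _ mCB))/= setIAC (setIidr DC) PC PD.
    rewrite (measureD mC mD (Plty _ mC))/=.
    by rewrite (setIidr DC) muleBl// ?fin_num_measure// fin_num_adde_defr// fin_num_measure.
  + move=> F ndF FH; have mF i : measurable (F i) by case: (FH i).
    have mU : measurable (\bigcup_i F i) by exact: bigcupT_measurable.
    split => //.
    have cF : (P \o F) @ \oo --> P (\bigcup_i F i).
      exact: nondecreasing_cvg_mu.
    have cFB : (P \o (fun i => F i `&` y n @^-1` B)) @ \oo -->
        P (\bigcup_i (F i `&` y n @^-1` B)).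
      apply: nondecreasing_cvg_mu => //.
      * by move=> i; exact: measurableI.
      * by apply: bigcupT_measurable => i; exact: measurableI.
      * by move=> i j ij; apply/subsetPset; apply: setSI; exact/subsetPset/ndF.
    rewrite setI_bigcupl; apply: (cvg_unique _ cFB) => //.
    rewrite (_ : P \o _ = fun i => (P (F i) * P (y n @^-1` B))%E); last first.
      by apply/funext => i /=; case: (FH i).
    by apply: cvgeZr => //; rewrite fin_num_measure.
- move=> C GC; have mC := rectangles_measurable GC.
  split => //; case: GC => C' mC' ->.
  pose E i := if (i < n)%N then C' i else B.
  have EC i : i \in iota 0 n -> E i = C' i.
    by rewrite mem_iota add0n /E => /andP[_ ->].
  have En : E n = B by rewrite /E ltnn.
  have mE i : measurable (E i) by rewrite /E; case: ifP.
  have -> : \big[setI/setT]_(i <- iota 0 n) (y i @^-1` C' i) =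
      \big[setI/setT]_(i <- iota 0 n) (y i @^-1` E i).
    by rewrite big_seq [RHS]big_seq; apply: eq_bigr => i /EC ->.
  rewrite -En (indep (iota_uniq 0 n) (fun i _ => mE i)).
  have := indep (iota_uniq 0 n.+1) (fun i _ => mE i).
  by rewrite -addn1 iotaD !big_cat/= add0n !big_seq1.
Qed.

Lemma Rintegral_mul_past n (k : nat) (Z : T -> R) :
  bounded_measurable (Z : past n -> R) -> bounded_measurable (y n) ->
  \int[P]_w (Z w * y n w ^+ k) = \int[P]_w Z w * \int[P]_w (y n w ^+ k).
Proof.
move=> [mZ bZ] by_; apply: Rintegral_mul_indep.
- by split => //; exact: measurable_fun_past mZ.
- exact: bounded_measurableX.
move=> A B mA mB.
rewrite (_ : (fun w => y n w ^+ k) @^-1` B = y n @^-1` ((fun t => t ^+ k) @^-1` B))//.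
apply: past_indep; first by rewrite -[X in measurable X]setTI; exact: mZ.
by rewrite -[X in measurable X]setTI; exact: measurable_funX.
Qed.

End past.

(** * Survival of a random walk with bounded steps *)

Ltac bounded_measurability :=
  repeat first [ assumption | exact: bounded_measurable_cst
    | exact: bounded_measurable_bool
    | apply: bounded_measurableD | apply: bounded_measurableN
    | apply: bounded_measurableM | apply: bounded_measurableX ].

Section random_walk.
Context d (T : measurableType d) (R : realType) (P : probability T R).
Variables (y : nat -> T -> R) (M s2 m3 u : R).
Hypothesis my : forall n, measurable_fun setT (y n).
Hypothesis yM : forall n w, `|y n w| <= M.
Hypothesis indep : mutually_independent P y.
Hypothesis Ey : forall n, \int[P]_w y n w = 0.
Hypothesis Ey2 : forall n, \int[P]_w (y n w ^+ 2) = s2.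
Hypothesis Ey3 : forall n, \int[P]_w (y n w ^+ 3) = m3.

Local Notation E f := (\int[P]_w f w).
Local Notation past_bounded n f := (@bounded_measurable _ (past y n) R f).

Lemma past_bounded_measurable n (f : T -> R) :
  past_bounded n f -> bounded_measurable f.
Proof. by move=> [mf bf]; split => //; exact: measurable_fun_past mf. Qed.

Lemma past_bounded_integrable n (f : T -> R) :
  past_bounded n f -> P.-integrable setT (EFin \o f).
Proof. by move=> /past_bounded_measurable; exact: bounded_measurable_integrable. Qed.

Lemma past_boundedS n (f : T -> R) : past_bounded n f -> past_bounded n.+1 f.
Proof. by move=> [mf bf]; split => //; exact: measurable_fun_pastS. Qed.

Lemma past_bounded_step i n : (i < n)%N -> past_bounded n (y i).
Proof. by move=> ni; split; [exact: past_step|exists M => w; exact: yM]. Qed.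

Lemma Rintegral_le n (f g : T -> R) : past_bounded n f -> past_bounded n g ->
  (forall w, f w <= g w) -> E f <= E g.
Proof.
move=> bf bg fg; apply: le_Rintegral => //.
- exact: past_bounded_integrable bf.
- exact: past_bounded_integrable bg.
Qed.

Lemma Rintegral_cubic n (A0 A1 A2 A3 : T -> R) :
  past_bounded n A0 -> past_bounded n A1 ->
  past_bounded n A2 -> past_bounded n A3 ->
  E (fun w => A0 w + A1 w * y n w + A2 w * y n w ^+ 2 + A3 w * y n w ^+ 3) =
  E A0 + E A2 * s2 + E A3 * m3.
Proof.
move=> b0 b1 b2 b3; have b_y := past_bounded_step (ltnSn n).
have by_ : bounded_measurable (y n) by exact: past_bounded_measurable b_y.
have [c0 c1 c2 c3] := And4 (past_boundedS b0) (past_boundedS b1)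
  (past_boundedS b2) (past_boundedS b3).
rewrite !RintegralD//;
  try by apply: (@past_bounded_integrable n.+1); bounded_measurability.
rewrite (Rintegral_mul_past my indep 2 b2 by_) Ey2.
rewrite (Rintegral_mul_past my indep 3 b3 by_) Ey3.
by rewrite (Rintegral_mul_past my indep 1 b1 by_) Ey mulr0 addr0.
Qed.

Definition gap n w := u - \sum_(i < n) y i w.

Lemma gapS n w : gap n.+1 w = gap n w - y n w.
Proof. by rewrite /gap big_ord_recr/= opprD addrA. Qed.

Lemma past_bounded_gap n : past_bounded n (gap n).
Proof.
rewrite /gap; bounded_measurability.
by apply: bounded_measurable_sum => i; exact: past_bounded_step.
Qed.

Definition survives n w := [forall k : 'I_n, 0 <= gap k.+1 w].

Lemma survivesS n w : survives n.+1 w = survives n w && (0 <= gap n.+1 w).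
Proof.
apply/forallP/andP => [h|[/forallP h h' k]].
  by split; [apply/forallP => k; exact: (h (widen_ord (leqnSn n) k))|exact: (h ord_max)].
have [kn|nk] := ltnP k n; first exact: (h (Ordinal kn)).
by rewrite (_ : val k = n)//; apply/eqP; rewrite eqn_leq nk -ltnS ltn_ord.
Qed.

Lemma survives0 w : survives 0 w.
Proof. by apply/forallP => -[]. Qed.

Lemma survives_gap n w : 0 <= u -> survives n w -> 0 <= gap n w.
Proof.
case: n => [u0 _|n _]; first by rewrite /gap big_ord0 subr0.
by rewrite survivesS => /andP[].
Qed.

Lemma past_ge_gap n (c : R) :
  measurable_fun (setT : set (past y n)) (fun w => c <= gap n w).
Proof.
by apply: measurable_fun_ler; [exact: measurable_cst|have [] := past_bounded_gap n].
Qed.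

Lemma past_le_gap n (c : R) :
  measurable_fun (setT : set (past y n)) (fun w => gap n w <= c).
Proof.
by apply: measurable_fun_ler; [have [] := past_bounded_gap n|exact: measurable_cst].
Qed.

Lemma past_survives n : measurable_fun (setT : set (past y n)) (survives n).
Proof.
elim: n => [|n ih].
  by rewrite (_ : survives 0 = cst true)//; apply/funext => w; rewrite survives0.
rewrite (_ : survives n.+1 = fun w => survives n w && (0 <= gap n.+1 w)); last first.
  by apply/funext => w; rewrite survivesS.
apply: measurable_and; last exact: past_ge_gap.
exact: measurable_fun_pastS.
Qed.

(* Averaging [caloric t c m] over one step of the walk gives [caloric t c m.+1]. *)
Definition caloric (t c : R) (m : nat) (v : R) : R :=
  v - t * (v ^+ 3 + 3 * m%:R * s2 * v - m%:R * m3) - c.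

Lemma Rintegral_caloric t c m n (b : T -> bool) :
  measurable_fun (setT : set (past y n)) b ->
  E (fun w => (b w)%:R * caloric t c m.+1 (gap n w)) =
  E (fun w => (b w)%:R * caloric t c m (gap n.+1 w)).
Proof.
move=> mb; have bb : past_bounded n (fun w => (b w)%:R) by exact: bounded_measurable_bool.
have bg := past_bounded_gap n.
pose A0 w := (b w)%:R * caloric t c m (gap n w).
pose A1 w := (b w)%:R * (t * (3 * gap n w ^+ 2 + 3 * m%:R * s2) - 1).
pose A2 w := (b w)%:R * (- 3 * t * gap n w).
pose A3 w := (b w)%:R * t.
have b0 : past_bounded n A0 by rewrite /A0 /caloric; bounded_measurability.
have b1 : past_bounded n A1 by rewrite /A1; bounded_measurability.
have b2 : past_bounded n A2 by rewrite /A2; bounded_measurability.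
have b3 : past_bounded n A3 by rewrite /A3; bounded_measurability.
transitivity (E (fun w =>
  A0 w + A1 w * y n w + A2 w * y n w ^+ 2 + A3 w * y n w ^+ 3)); last first.
  by apply: eq_Rintegral => w _; rewrite gapS /A0 /A1 /A2 /A3 /caloric; ring.
rewrite (Rintegral_cubic b0 b1 b2 b3).
rewrite -!RintegralZr ?(past_bounded_integrable b2) ?(past_bounded_integrable b3)//.
rewrite -!RintegralD//;
  try by apply: (@past_bounded_integrable n); bounded_measurability.
apply: eq_Rintegral => w _; rewrite /A0 /A2 /A3 /caloric -natr1; ring.
Qed.

Lemma caloric_le_survival t c N : 0 <= u -> 0 <= t ->
  t * M ^+ 2 + 3 * N%:R * t * s2 <= 1 -> 0 <= s2 ->
  t * N%:R * `|m3| <= c ->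
  caloric t c N u <= E (fun w => (survives N w)%:R * caloric t c 0 (gap N w)).
Proof.
move=> u0 t0 tN s20 tc.
suff H n m : (n + m)%N = N -> caloric t c N u <=
    E (fun w => (survives n w)%:R * caloric t c m (gap n w)).
  by apply: H; rewrite addn0.
elim: n m => [m|n ih m nmN].
  rewrite add0n => ->; rewrite le_eqVlt; apply/orP; left; apply/eqP.
  transitivity (E (fun=> caloric t c N u)).
    by rewrite Rintegral_cst//= probability_setT mulr1.
  by apply: eq_Rintegral => w _; rewrite survives0 mul1r /gap big_ord0 subr0.
rewrite (le_trans (ih m.+1 _)) -?nmN ?addSnnS//.
rewrite (Rintegral_caloric _ _ _ (@past_survives n)).
have bs : past_bounded n.+1 (fun w => (survives n w)%:R).
  by apply: past_boundedS; apply: bounded_measurable_bool; exact: past_survives.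
have bs' : past_bounded n.+1 (fun w => (survives n.+1 w)%:R).
  by apply: bounded_measurable_bool; exact: past_survives.
have bg := past_bounded_gap n.+1.
apply: (@Rintegral_le n.+1); try by rewrite /caloric; bounded_measurability.
move=> w; rewrite survivesS; case: (boolP (survives n w)) => [sn|_]; last by rewrite !mul0r.
case: (boolP (0 <= gap n.+1 w)) => [_|]; first by [].
rewrite -ltNge mul1r mul0r => g0.
have gM : - M <= gap n.+1 w.
  have := survives_gap u0 sn; have := yM n w; rewrite ler_norml => /andP[_].
  by rewrite gapS; lra.
move: (gap n.+1 w) g0 gM => v v0 vM.
have mN : (m%:R : R) <= N%:R by rewrite ler_nat -nmN leq_addl.
have v2 : v ^+ 2 <= M ^+ 2 by rewrite -sqrrN lerXn2r// ?nnegrE; lra.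
have h1 : t * v ^+ 2 <= t * M ^+ 2 by exact: ler_wpM2l.
have h2 : m%:R * (t * s2) <= N%:R * (t * s2) by rewrite ler_wpM2r// mulr_ge0.
have h3 : t * m%:R * m3 <= t * N%:R * `|m3|.
  rewrite (le_trans (ler_norm _))// !normrM (ger0_norm t0) normr_nat.
  by rewrite ler_wpM2r// ler_wpM2l.
have h4 : v * (1 - t * v ^+ 2 - 3 * m%:R * t * s2) <= 0.
  by rewrite nmulr_rle0//; lra.
rewrite /caloric; move: h4 h3 tc; rewrite !mulrBr; lra.
Qed.

Lemma second_moment_ge0 : 0 <= s2.
Proof. by rewrite -(Ey2 0); apply: Rintegral_ge0 => w _; exact: sqr_ge0. Qed.

Lemma past_bounded_cst n (c : R) : past_bounded n (fun=> c).
Proof. exact: bounded_measurable_cst. Qed.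

Lemma Rintegral_probability_cst (c : R) : E (fun=> c) = c.
Proof. by rewrite Rintegral_cst//= probability_setT mulr1. Qed.

Lemma moment_le k : `|E (fun w => y 0 w ^+ k)| <= M ^+ k.
Proof.
have b_y := past_bounded_step (ltnSn 0).
have by_ : past_bounded 1 (fun w => y 0 w ^+ k) by bounded_measurability.
rewrite (le_trans (le_normr_Rintegral _ (past_bounded_integrable by_)))//.
rewrite -(Rintegral_probability_cst (M ^+ k)); apply: (@Rintegral_le 1).
- have [mk [K kK]] := by_; split; first exact: measurableT_comp.
  by exists K => w; rewrite normr_id.
- exact: past_bounded_cst.
by move=> w; rewrite normrX lerXn2r// nnegrE// (le_trans _ (yM 0 w)).
Qed.

Lemma survival_lower N : 0 < M -> 8 * M <= u -> (0 < N)%N ->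
  2 * u ^+ 2 <= N%:R * M ^+ 2 ->
  1 / 4 <= E (fun w => (survives N w)%:R) * Num.sqrt N%:R.
Proof.
move=> M0 uM N0 uN.
pose r : R := Num.sqrt N%:R.
have NR0 : 0 < (N%:R : R) by rewrite ltr0n.
have r0 : 0 < r by rewrite sqrtr_gt0.
have r2 : r ^+ 2 = N%:R by rewrite sqr_sqrtr// ltW.
(* [caloric t c 0] is at most [1 / sqrt t = 2 M r] on [[0, +oo[]. *)
pose t : R := (2 * M * r) ^- 2.
have t0 : 0 < t by rewrite invr_gt0 exprn_gt0// !mulr_gt0.
have tNM : t * (N%:R * M ^+ 2) = 1 / 4.
  rewrite /t -r2; field; apply/andP; split; lra.
have s2M : s2 <= M ^+ 2.
  by rewrite -(Ey2 0) (le_trans (ler_norm _))// moment_le.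
have m3M : `|m3| <= M ^+ 3 by rewrite -(Ey3 0) moment_le.
have s20 := second_moment_ge0.
have N1 : 1 <= (N%:R : R) by rewrite ler1n.
have u0 : 0 <= u by lra.
pose c := M / 4.
have H := @caloric_le_survival t c N u0 (ltW t0).
have h1 : t * M ^+ 2 <= 1 / 4.
  rewrite -tNM ler_wpM2l ?(ltW t0)// ler_peMl// exprn_ge0//; lra.
have h2 : N%:R * t * s2 <= 1 / 4.
  rewrite -tNM [N%:R * t]mulrC -mulrA ler_wpM2l ?(ltW t0)// ler_wpM2l//; lra.
have h3 : t * N%:R * `|m3| <= c.
  rewrite (@le_trans _ _ (t * N%:R * M ^+ 3))//.
    by rewrite ler_wpM2l// mulr_ge0// ltW.
  have -> : t * N%:R * M ^+ 3 = M * (t * (N%:R * M ^+ 2)) by ring.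
  by rewrite tNM /c; lra.
have h0 : t * M ^+ 2 + 3 * N%:R * t * s2 <= 1 by lra.
have {}H := H h0 s20 h3.
have h4 : t * u ^+ 2 <= 1 / 8.
  have := ler_wpM2l (ltW t0) uN; rewrite tNM; lra.
have low : M / 2 <= caloric t c N u.
  have h5 : - (M / 4) <= t * N%:R * m3.
    have := ler_norm (- m3); rewrite normrN => hm.
    have : - (t * N%:R * m3) <= t * N%:R * `|m3|.
      by rewrite -mulrN ler_wpM2l// mulr_ge0// ltW.
    rewrite /c in h3; lra.
  have h6 : u * (1 / 8) <= u * (1 - t * u ^+ 2 - 3 * (N%:R * t * s2)).
    by rewrite ler_wpM2l//; lra.
  rewrite /caloric /c; move: h5 h6; rewrite !mulrBr; lra.
have bs : past_bounded N (fun w => (survives N w)%:R).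
  by apply: bounded_measurable_bool; exact: past_survives.
have bg := past_bounded_gap N.
have up : E (fun w => (survives N w)%:R * caloric t c 0 (gap N w)) <=
    E (fun w => (survives N w)%:R * (2 * M * r)).
  apply: (@Rintegral_le N); try by rewrite /caloric; bounded_measurability.
  move=> w; case: (boolP (survives N w)) => [sN|_]; last by rewrite !mul0r.
  rewrite !mul1r; have := survives_gap u0 sN; move: (gap N w) => v v0.
  have k0 : 0 < 2 * M * r by rewrite !mulr_gt0.
  have [vk|kv] := leP v (2 * M * r).
    rewrite /caloric /c mul0r mulr0 !mul0r subr0 addr0.
    have : 0 <= t * v ^+ 3 by rewrite mulr_ge0 ?exprn_ge0// ltW.
    lra.
  have : 1 <= t * v ^+ 2.
    rewrite /t mulrC ler_pdivlMr ?exprn_gt0// mul1r lerXn2r ?nnegrE//; exact: ltW.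
  move=> /(ler_wpM2r v0); rewrite /caloric /c.
  rewrite mul0r mulr0 !mul0r subr0 addr0 exprSr mulrA; lra.
move: (le_trans low (le_trans H up)).
rewrite RintegralZr//; last exact: past_bounded_integrable bs.
rewrite -/r; move: (\int[P]_w _) => q hq.
have : M * (1 / 2) <= M * (2 * (q * r)) by lra.
by rewrite ler_pM2l//; lra.
Qed.

Section upper.
Variables (L : R).

Fixpoint inside n w : bool :=
  if n is m.+1 then inside m w && ((0 <= gap n w) && (gap n w <= L)) else true.

Fixpoint exits_top n w : bool :=
  if n is m.+1 then exits_top m w || inside m w && (L < gap n w) else false.

Lemma survives_sub n w : survives n w -> inside n w || exits_top n w.
Proof.
elim: n => [//|n ih]; rewrite survivesS => /andP[/ih + g0]/=.
rewrite g0/= => /orP[->|->]; last by rewrite !orbT.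
by rewrite /= ltNge; case: (_ <= L); rewrite ?orbT.
Qed.

Lemma past_inside n : measurable_fun (setT : set (past y n)) (inside n).
Proof.
elim: n => [|n ih]; first exact: measurable_cst.
apply: measurable_and; first exact: measurable_fun_pastS.
by apply: measurable_and; [exact: past_ge_gap|exact: past_le_gap].
Qed.

Lemma past_exits_top n : measurable_fun (setT : set (past y n)) (exits_top n).
Proof.
elim: n => [|n ih]; first exact: measurable_cst.
apply: measurable_or; first exact: measurable_fun_pastS.
apply: measurable_and; first by apply: measurable_fun_pastS; exact: past_inside.
apply: measurable_fun_ltr; first exact: measurable_cst.
by have [] := past_bounded_gap n.+1.
Qed.

Definition parabola (v : R) : R := (v + M) * (2 * L + M - v).

Lemma Rintegral_parabola n (b : T -> bool) (k : R) :
  measurable_fun (setT : set (past y n)) b ->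
  E (fun w => (b w)%:R * (parabola (gap n w) + k)) =
  E (fun w => (b w)%:R * (parabola (gap n.+1 w) + (k + s2))).
Proof.
move=> mb; have bb : past_bounded n (fun w => (b w)%:R) by exact: bounded_measurable_bool.
have bg := past_bounded_gap n.
pose A0 w := (b w)%:R * (parabola (gap n w) + (k + s2)).
pose A1 w := (b w)%:R * (gap n w + M - (2 * L + M - gap n w)).
pose A2 w : R := (b w)%:R * (- 1).
pose A3 w : R := (b w)%:R * 0.
have b0 : past_bounded n A0 by rewrite /A0 /parabola; bounded_measurability.
have b1 : past_bounded n A1 by rewrite /A1; bounded_measurability.
have b2 : past_bounded n A2 by rewrite /A2; bounded_measurability.
have b3 : past_bounded n A3 by rewrite /A3; bounded_measurability.
transitivity (E (fun w =>
  A0 w + A1 w * y n w + A2 w * y n w ^+ 2 + A3 w * y n w ^+ 3)); last first.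
  by apply: eq_Rintegral => w _; rewrite gapS /A0 /A1 /A2 /A3 /parabola; ring.
rewrite (Rintegral_cubic b0 b1 b2 b3).
rewrite -!RintegralZr ?(past_bounded_integrable b2) ?(past_bounded_integrable b3)//.
rewrite -!RintegralD//;
  try by apply: (@past_bounded_integrable n); bounded_measurability.
apply: eq_Rintegral => w _; rewrite /A0 /A2 /A3; ring.
Qed.

Lemma survival_le_parabola N : 0 <= M -> 0 <= u <= L -> s2 * N%:R <= L ^+ 2 ->
  s2 * N%:R * E (fun w => (survives N w)%:R) <= parabola u.
Proof.
move=> M0 /andP[u0 uL] LN; have s20 := second_moment_ge0.
have LN0 : 0 <= s2 * N%:R by rewrite mulr_ge0.
have L0 : 0 <= L by lra.
have W0 v : - M <= v -> v <= L + M -> 0 <= parabola v.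
  by move=> h1 h2; rewrite mulr_ge0//; lra.
have WL v : L <= v -> v <= L + M -> s2 * N%:R <= parabola v.
  move=> h1 h2; rewrite (le_trans LN)// expr2 /parabola ler_pM//; lra.
have insideE n w : inside n w -> 0 <= gap n w <= L.
  by case: n => [_|n /= /andP[]//]; rewrite /gap big_ord0 subr0 u0.
have bi n m : (n <= m)%N -> past_bounded m (fun w => (inside n w)%:R).
  move=> /subnK <-; elim: (m - n)%N => [|k]; last exact: past_boundedS.
  by apply: bounded_measurable_bool; exact: past_inside.
have bt n m : (n <= m)%N -> past_bounded m (fun w => (exits_top n w)%:R).
  move=> /subnK <-; elim: (m - n)%N => [|k]; last exact: past_boundedS.
  by apply: bounded_measurable_bool; exact: past_exits_top.
(* A supermartingale: below [0] the parabola is nonnegative, and above [L] it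
   exceeds [s2 * N]. *)
pose Phi n w := (inside n w)%:R * (parabola (gap n w) + n%:R * s2) +
                (exits_top n w)%:R * (s2 * N%:R).
have dec n : E (Phi n) <= parabola u.
  elim: n => [|n]; last first.
    apply: le_trans; rewrite /Phi.
    have [bin bin' bin1] :=
      And3 (bi n n (leqnn n)) (bi n n.+1 (leqnSn n)) (bi n.+1 n.+1 (leqnn _)).
    have [btn btn' btn1] :=
      And3 (bt n n (leqnn n)) (bt n n.+1 (leqnSn n)) (bt n.+1 n.+1 (leqnn _)).
    have bg := past_bounded_gap n; have bg1 := past_bounded_gap n.+1.
    rewrite [leRHS]RintegralD//;
      try by apply: (@past_bounded_integrable n); rewrite /parabola; bounded_measurability.
    rewrite (Rintegral_parabola _ (@past_inside n)) -RintegralD//;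
      try by apply: (@past_bounded_integrable n.+1); rewrite /parabola; bounded_measurability.
    apply: (@Rintegral_le n.+1); try by rewrite /parabola; bounded_measurability.
    move=> w /=; case: (boolP (inside n w)) => [/insideE/andP[g0 gL]|_]; last first.
      by rewrite !mul0r/= orbF.
    have := yM n w; rewrite ler_norml => /andP[y1 y2].
    have gE := gapS n w.
    have W1 := W0 (gap n.+1 w); have W2 := WL (gap n.+1 w).
    have nn : 0 <= (n%:R : R) * s2 by rewrite mulr_ge0.
    rewrite /= -natr1 mulrDl mul1r.
    move: (gap n.+1 w) (parabola (gap n.+1 w)) gE W1 W2 => v p gE W1 W2.
    have {}W1 : 0 <= p by apply: W1; lra.
    have [v0|v0] := leP 0 v; have [vL|vL] := leP v L;
      case: (exits_top n w) => /=; rewrite ?mul1r ?mul0r; lra.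
  rewrite -[leRHS](Rintegral_probability_cst) le_eqVlt; apply/orP; left; apply/eqP.
  apply: eq_Rintegral => w _.
  by rewrite /Phi/= /gap big_ord0 subr0 mul0r mul0r !addr0 mul1r.
apply: le_trans (dec N).
have bs : past_bounded N (fun w => (survives N w)%:R).
  by apply: bounded_measurable_bool; exact: past_survives.
have [bin btn bg] := And3 (bi N N (leqnn N)) (bt N N (leqnn N)) (past_bounded_gap N).
rewrite -RintegralZl//; last exact: past_bounded_integrable bs.
apply: (@Rintegral_le N); rewrite /Phi; try by rewrite /parabola; bounded_measurability.
move=> w; have := @survives_sub N w; have := @insideE N w.
have Wg := W0 (gap N w); move: (parabola _) Wg => q Wg.
case: (inside N w) => /= [/(_ isT)/andP[g0 gL] _|_].
  have q0 : 0 <= q by apply: Wg; lra.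
  case: (survives N w); case: (exits_top N w); rewrite ?mulr0 ?mulr1 ?mul1r ?mul0r; lra.
case: (survives N w) => [/(_ isT) ->|_]; first by rewrite mul0r add0r mul1r mulr1.
case: (exits_top N w); rewrite mulr0 mul0r add0r ?mul1r ?mul0r; lra.
Qed.
End upper.

Lemma survival_upper N : 0 < M -> (0 < N)%N -> 0 <= u <= M * Num.sqrt N%:R ->
  s2 * (E (fun w => (survives N w)%:R) * Num.sqrt N%:R) <= 3 * M * (u + M).
Proof.
move=> M0 N0; pose r : R := Num.sqrt N%:R; rewrite -/r => ur.
have NR0 : 0 < (N%:R : R) by rewrite ltr0n.
have r0 : 0 < r by rewrite sqrtr_gt0.
have r2 : r ^+ 2 = N%:R by rewrite sqr_sqrtr// ltW.
have r1 : 1 <= r by rewrite -(@sqrtr1 R) ler_sqrt ?ler1n.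
have s2M : s2 <= M ^+ 2.
  by rewrite -(Ey2 0) (le_trans (ler_norm _))// moment_le.
have := @survival_le_parabola (M * r) N (ltW M0) ur.
have -> : s2 * N%:R <= (M * r) ^+ 2 by rewrite exprMn r2 ler_wpM2r// ltW.
move=> /(_ isT); rewrite -r2; move: (\int[P]_w _) => q hq.
have : parabola (M * r) u <= (u + M) * (3 * M * r).
  rewrite /parabola ler_wpM2l//; first lra.
  have : M <= M * r by rewrite ler_peMr// ltW.
  lra.
move=> /(le_trans hq) {}hq.
rewrite -(ler_pM2r r0); lra.
Qed.

End random_walk.

(** * Transfer to the autoregressive process *)

Lemma asymp_ratio_bounds (R : realType) (r : nat -> \bar R) (c C : R) :
  0 < c -> (\forall N \near \oo, (c%:E <= r N <= C%:E)%E) -> asymp_ratio r.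
Proof.
move=> c0 [N0 _ rN]; split.
  rewrite limn_einf_lim (@lt_le_trans _ _ c%:E) ?lte_fin//.
  apply: lime_ge; first exact: is_cvg_einfs.
  exists N0 => // n /= nN; apply: le_ereal_inf_tmp => _ [k /= nk <-].
  by have /andP[] := rN k (leq_trans nN nk).
rewrite limn_esup_lim (@le_lt_trans _ _ C%:E) ?ltry//.
apply: lime_le; first exact: is_cvg_esups.
exists N0 => // n /= nN; apply: ge_ereal_sup => _ [k /= nk <-].
by have /andP[] := rN k (leq_trans nN nk).
Qed.

Lemma probability_le_ae d (T : measurableType d) (R : realType)
    (P : probability T R) (A B : set T) : measurable A -> measurable B ->
  (\forall w \ae P, A w -> B w) -> (P A <= P B)%E.
Proof.
move=> mA mB [N [mN PN AB]].
have sAB : A `<=` B `|` N.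
  move=> w Aw; have [Bw|nBw] := pselect (B w); [by left|right].
  by apply: AB => /(_ Aw).
have mBN : measurable (B `|` N) by exact: measurableU.
rewrite (le_trans (le_measure P _ _ sAB)) ?inE//.
by rewrite (le_trans (measureU2 P mB mN))//= PN adde0.
Qed.

Lemma Rintegral_bool d (T : measurableType d) (R : realType)
    (P : probability T R) (b : T -> bool) : measurable_fun setT b ->
  P [set w | b w] = (\int[P]_w ((b w)%:R : R))%:E.
Proof.
move=> mb; have mA : measurable [set w | b w].
  rewrite (_ : [set w | b w] = setT `&` b @^-1` [set true]); first exact: mb.
  by apply/seteqP; split => [w bw|w [_]].
have bE w : (b w)%:R = \1_[set w | b w] w :> R.
  by rewrite indicE; case: (boolP (b w)) => bw;
    [rewrite mem_set|rewrite memNset//; exact/negP].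
rewrite /Rintegral; under eq_integral do rewrite bE.
by rewrite integral_indic// setIT fineK// fin_num_measure.
Qed.

Lemma Rintegral_same_law d (T : measurableType d) (R : realType)
    (P : probability T R) (f g : T -> R) k :
  bounded_measurable f -> bounded_measurable g ->
  (forall B : set R, measurable B -> P (f @^-1` B) = P (g @^-1` B)) ->
  \int[P]_w (f w ^+ k) = \int[P]_w (g w ^+ k).
Proof.
move=> bf bg fg; have [mf _] := bf; have [mg _] := bg.
pose F : {mfun T >-> R} := HB.pack f (isMeasurableFun.Build _ _ _ _ f mf).
pose G : {mfun T >-> R} := HB.pack g (isMeasurableFun.Build _ _ _ _ g mg).
pose h (t : R) := (t ^+ k)%:E.
have mh : measurable_fun setT h.
  by apply/measurable_EFinP; exact: measurable_funX.
have ih f' : bounded_measurable f' -> P.-integrable setT (h \o f').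
  move=> bf'; apply: (bounded_measurable_integrable P (f := fun w => f' w ^+ k)).
  exact: bounded_measurableX.
rewrite /Rintegral; congr fine.
rewrite -(@integral_distribution _ _ _ _ _ P F h mh (ih _ bf)).
rewrite -(@integral_distribution _ _ _ _ _ P G h mh (ih _ bg)).
by apply: eq_measure_integral => A mA _; exact: fg.
Qed.

Lemma random_walk_survival d (T : measurableType d) (R : realType)
    (P : probability T R) (y : nat -> T -> R) (M u : R) :
  (forall n, measurable_fun setT (y n)) -> (forall n w, `|y n w| <= M) ->
  mutually_independent P y -> identically_distributed P y ->
  \int[P]_w y 0 w = 0 -> 0 < \int[P]_w (y 0 w ^+ 2) ->
  0 < M -> 8 * M <= u ->
  exists C : R, \forall N \near \oo,
    (((1 / 4)%:E <= P [set w | forall n, (1 <= n <= N)%N ->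
        (\sum_(i < n) y i w <= u)%R] * (Num.sqrt N%:R)%:E <= C%:E))%E.
Proof.
move=> my yM indep iid Ey Ey2 M0 uM.
have by_ n : bounded_measurable (y n) by split => //; exists M.
have law n k : \int[P]_w (y n w ^+ k) = \int[P]_w (y 0 w ^+ k).
  by apply: Rintegral_same_law => // B; exact: iid.
pose s2 := \int[P]_w (y 0 w ^+ 2).
have Ey1 n : \int[P]_w y n w = 0 by rewrite -Ey; exact: (law n 1%N).
exists (3 * M * (u + M) / s2).
pose N0 := Num.truncn (2 * u ^+ 2 / M ^+ 2).
exists N0.+1 => // N /= N0N.
have N_gt0 : (0 < N)%N by exact: leq_ltn_trans N0N.
have hN : 2 * u ^+ 2 / M ^+ 2 <= N%:R.
  rewrite (le_trans (ltW (truncnS_gt _)))// ler_nat.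
  by [].
have {}hN : 2 * u ^+ 2 <= N%:R * M ^+ 2 by rewrite -ler_pdivrMr// exprn_gt0.
have u0 : 0 <= u by lra.
have low := survival_lower my yM indep Ey1 (law^~ 2%N) (law^~ 3%N) M0 uM N_gt0 hN.
have NR0 : 0 <= (N%:R : R) by [].
have ur : 0 <= u <= M * Num.sqrt N%:R.
  rewrite u0/= -(ler_pXn2r (ltn0Sn 1)) ?nnegrE ?mulr_ge0 ?sqrtr_ge0//; last exact: ltW.
  rewrite exprMn sqr_sqrtr//; have := sqr_ge0 u; lra.
have up := survival_upper my yM indep Ey1 (law^~ 2%N) (law^~ 3%N) M0 N_gt0 ur.
have -> : [set w | forall n, (1 <= n <= N)%N -> \sum_(i < n) y i w <= u] =
    [set w | survives y u N w].
  apply/seteqP; split => w /=.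
    by move=> h; apply/forallP => k; rewrite /gap subr_ge0 h//= ltn_ord.
  move=> /forallP h [//|n] nN; have := h (Ordinal nN).
  by rewrite /gap subr_ge0.
rewrite Rintegral_bool; last first.
  apply: (measurable_fun_past my (n := N)).
  by apply: past_survives; exact: yM.
rewrite -EFinM !lee_fin low/= ler_pdivlMr// mulrC.
exact: up.
Qed.

Definition clip (R : realType) (M t : R) : R := Num.max (- M) (Num.min t M).

Lemma clip_norm (R : realType) (M t : R) : 0 <= M -> `|clip M t| <= M.
Proof.
move=> M0; rewrite ler_norml /clip le_max lexx/= ge_max ge_min lexx orbT andbT.
lra.
Qed.

Lemma clip_id (R : realType) (M t : R) : `|t| <= M -> clip M t = t.
Proof.
by rewrite ler_norml /clip => /andP[Mt tM]; rewrite (min_idPl tM) (max_idPr Mt).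
Qed.

Lemma measurable_clip (R : realType) (M : R) : measurable_fun setT (clip M).
Proof.
apply: measurable_maxr; first exact: measurable_cst.
by apply: measurable_minr; [exact: measurable_id|exact: measurable_cst].
Qed.

Lemma square_integral_gt0 d (T : measurableType d) (R : realType)
    (P : probability T R) (f : T -> R) : bounded_measurable f ->
  nondegenerate_rv P f -> 0 < \int[P]_w (f w ^+ 2).
Proof.
move=> bf nd; rewrite lt_neqAle Rintegral_ge0 ?andbT => [|w _]; last exact: sqr_ge0.
apply/eqP => f0; apply: nd; exists 0.
have [mf _] := bf.
have b2 := bounded_measurableX 2 bf.
have i2 := bounded_measurable_integrable P b2.
have f0' : (\int[P]_w (f w ^+ 2)%:E)%E = 0%E.
  by rewrite -[LHS]fineK ?(integrable_fin_num _ i2)// -/(Rintegral _ _ _) -f0.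
have abs0 : (\int[P]_w `|(f w ^+ 2)%:E|)%E = 0%E.
  by rewrite -f0'; apply: eq_integral => w _; rewrite gee0_abs// lee_fin sqr_ge0.
have m2 : measurable_fun setT (fun w => (f w ^+ 2)%:E).
  by apply/measurable_EFinP; case: b2.
have [+ _] := ae_eq_integral_abs P measurableT m2.
move=> /(_ abs0)[N [mN PN fN]].
have m0 : measurable (f @^-1` [set 0]).
  by rewrite -[X in measurable X]setTI; exact: mf.
apply/eqP; rewrite eq_le probability_le1//= -(probability_setT P).
apply: probability_le_ae => //; exists N; split => // w /= nw; apply: fN => /=.
apply: contra_not nw => /(_ I)[] /eqP; rewrite sqrf_eq0 => /eqP fw _.
exact: fw.
Qed.

Unset Implicit Arguments.

(* Y n stands for the innovation Y_{n+1}; X n stands for X_n (X 0 = 0). *)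
Theorem mainTheorem19 (d : measure_display) (T : measurableType d)
  (R : realType) (P : probability T R)
  (p : nat) (a : nat -> R) (Y : nat -> {RV P >-> R}) (X : nat -> T -> R)
  (M : R) :
  mutually_independent P (fun n => (Y n : T -> R)) ->
  identically_distributed P (fun n => (Y n : T -> R)) ->
  nondegenerate_rv P (Y 0%N) ->
  (forall z : complex.complex R,
      root (map_poly (fun c : R => complex.Complex c 0) (ar_char_poly p a)) z ->
      `|z| < 1) ->
  expectation P (Y 0%N) = 0%E ->
  (\forall w \ae P, `|Y 0%N w| <= M) ->
  X 0%N = (fun _ => 0) ->
  (forall n w, X n.+1 w =
      \sum_(1 <= k < p.+1) a k * X (n.+1 - k)%N w + Y n w) ->
  exists x0 : R, 0 <= x0 /\
    forall x : R, x0 <= x ->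
      asymp_ratio (fun N : nat =>
        (P [set w | forall n : nat, (1 <= n <= N)%N ->
                      (\sum_(1 <= j < n.+1) X j w <= x)%R]
         * (Num.sqrt (N%:R : R))%:E)%E).
Proof.
move=> indep iid nd stable EY YM X0 XS.
pose K : R := `|M| + 1.
have K0 : 0 < K by rewrite ltr_wpDl.
pose y n w := clip K (Y n w).
have mY n : measurable_fun setT (Y n : T -> R) by exact: measurable_funP.
have my n : measurable_fun setT (y n).
  by apply: measurableT_comp; [exact: measurable_clip|exact: mY].
have yK n w : `|y n w| <= K by apply: clip_norm; exact: ltW.
have mclip (B : set R) : measurable B -> measurable (clip K @^-1` B).
  by move=> mB; rewrite -[X in measurable X]setTI; exact: measurable_clip.
have indep_y : mutually_independent P y.
  by move=> s B us mB; apply: (indep s (fun i => clip K @^-1` B i)) => // i /mB; exact: mclip.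
have iid_y : identically_distributed P y.
  by move=> n B mB; apply: (iid n (clip K @^-1` B)); exact: mclip.
have full : \forall w \ae P, forall n, `|Y n w| <= K.
  apply: ae_foralln => n; pose B : set R := [set t | `|t| <= K].
  have mB : measurable B.
    rewrite (_ : B = `[- K, K]%classic)//.
    by apply/seteqP; split => t; rewrite /B /= in_itv/= ler_norml.
  have mYB k : measurable (Y k @^-1` ~` B).
    by rewrite -[X in measurable X]setTI; apply: mY => //; exact: measurableC.
  exists (Y n @^-1` ~` B); split => //.
  apply: etrans (iid n _ (measurableC mB)) _.
  apply/negligibleP => //; apply: negligibleS YM => w /=.
  apply: contra_not => YwM; rewrite /B /= /K (le_trans YwM)//.
  by rewrite (le_trans (ler_norm M))// lerDl.
have Ey0 : \int[P]_w y 0%N w = 0.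
  rewrite /Rintegral (ae_eq_integral (EFin \o Y 0%N)) //.
  - by move: EY; rewrite unlock => ->.
  - exact/measurable_EFinP.
  - exact/measurable_EFinP.
  - by apply: filterS full => w Yw _ /=; rewrite /y clip_id.
clear EY.
have nd_y : nondegenerate_rv P (y 0%N).
  move=> [c Pc]; apply: nd; exists c.
  have mset n (f : T -> R) : measurable_fun setT f -> measurable (f @^-1` [set n]).
    by move=> mf; rewrite -[X in measurable X]setTI; exact: mf.
  apply/eqP; rewrite eq_le probability_le1/=; last by apply: mset; exact: mY.
  rewrite -Pc.
  apply: probability_le_ae; [exact: mset|by apply: mset; exact: mY|].
  by apply: filterS full => w Yw /=; rewrite /y clip_id.
have by0 : bounded_measurable (y 0%N) by split => //; exists K.
have s2_gt0 := square_integral_gt0 by0 nd_y.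
pose I := {w | forall n, `|Y n w| <= K}.
have [C C0 XC] := @ar_bounded R p a stable I (fun w n => X n (sval w))
  (fun w n => Y n (sval w)) K (fun w n => svalP w n)
  (fun w => congr1 (@^~ (sval w)) X0) (fun w n => XS n (sval w)).
pose c1 : R := 1 - \sum_(1 <= k < p.+1) a k.
have c1_gt0 : 0 < c1 := ar_char_poly1_gt0 stable.
pose D : R := \sum_(1 <= k < p.+1) `|a k| * (k%:R * C).
have D0 : 0 <= D by apply: sumr_ge0 => k _; rewrite !mulr_ge0.
have close w n : (forall n, `|Y n w| <= K) ->
    `|c1 * (\sum_(1 <= j < n.+1) X j w) - \sum_(i < n) y i w| <= D.
  move=> Yw; under [X in _ - X]eq_bigr do rewrite /y clip_id//.
  apply: (@ar_partial_sum_close R p a (X^~ w) (Y^~ w)).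
  - by rewrite X0.
  - by move=> k; exact: XS.
  - by move=> k; exact: (XC (exist _ w Yw)).
have mX n : measurable_fun setT (X n).
  suff: forall m, (m <= n)%N -> measurable_fun setT (X m) by apply.
  elim: n => [m|n ih m]; first by rewrite leqn0 => /eqP ->; rewrite X0.
  rewrite leq_eqVlt => /predU1P[->|]; last exact: ih.
  rewrite (_ : X n.+1 = fun w =>
    \sum_(0 <= k < p) a k.+1 * X (n - k)%N w + Y n w); last first.
    by apply/funext => w; rewrite XS big_add1.
  apply: measurable_funD => //; apply: measurable_sum => k.
  by apply: measurable_funM => //; apply: ih; exact: leq_subr.
clear X0.
have mev (f : nat -> T -> R) (v : R) N : (forall n, measurable_fun setT (f n)) ->
    measurable [set w | forall n, (1 <= n <= N)%N -> f n w <= v].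
  move=> mf; rewrite (_ : mkset _ =
      \bigcap_(n in [set n | (1 <= n <= N)%N]) (f n @^-1` [set` `]-oo, v]])).
    apply: bigcap_measurableType => n _.
    by rewrite -[X in measurable X]setTI; exact: mf.
  by apply/seteqP; split => w /= h n /h; rewrite /= in_itv.
have mZ n : measurable_fun setT (fun w => \sum_(1 <= j < n.+1) X j w).
  exact: measurable_sum.
have mS n : measurable_fun setT (fun w => \sum_(i < n) y i w).
  by apply: measurable_sum => i; exact: my.
exists ((D + 8 * K) / c1); split; first by rewrite divr_ge0; lra.
move=> x; rewrite ler_pdivrMr// mulrC => xD.
have [|Cl lo] := random_walk_survival (u := c1 * x - D) my yK indep_y iid_y Ey0 s2_gt0 K0.
  by lra.
have [|Cu up] := random_walk_survival (u := c1 * x + D) my yK indep_y iid_y Ey0 s2_gt0 K0.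
  by lra.
apply: (@asymp_ratio_bounds _ _ (1 / 4) Cu); first by lra.
near=> N; apply/andP; split.
- have /andP[+ _] : ((1 / 4)%:E <= P [set w | forall n, (1 <= n <= N)%N ->
    (\sum_(i < n) y i w <= c1 * x - D)%R] * (Num.sqrt N%:R)%:E <= Cl%:E)%E.
    by near: N.
  move=> /le_trans; apply; apply: lee_wpmul2r; first by rewrite lee_fin sqrtr_ge0.
  apply: probability_le_ae; [exact: mev|exact: mev|].
  apply: filterS full => w Yw h n /h Sn; have := close w n Yw.
  rewrite ler_norml => /andP[_ cl]; rewrite -(ler_pM2l c1_gt0); lra.
- have /andP[_] : ((1 / 4)%:E <= P [set w | forall n, (1 <= n <= N)%N ->
    (\sum_(i < n) y i w <= c1 * x + D)%R] * (Num.sqrt N%:R)%:E <= Cu%:E)%E.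
    by near: N.
  apply: le_trans; apply: lee_wpmul2r; first by rewrite lee_fin sqrtr_ge0.
  apply: probability_le_ae; [exact: mev|exact: mev|].
  apply: filterS full => w Yw h n /h Sn; have := close w n Yw.
  rewrite ler_norml => /andP[cl _]; move: Sn; rewrite -(ler_pM2l c1_gt0); lra.
Unshelve. all: by end_near.
Qed.
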